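(* Let $X$ be a non-degenerate real-valued random variable whose distribution is supported on a discrete set $\mathbb{S}\subset\mathbb{R}$ ($\mathbb{S}$ is finite, or countably infinite but locally finite, and $\mathbf{P}\{X=z\}>0$ for every $z\in\mathbb{S}$). Let $\Phi$ be a real-valued function on $\mathbb{S}$, extended to the smallest closed interval containing $\mathbb{S}$ by connecting adjacent points of its graph with line segments, and assume that the extended function $\Phi$ is convex. Let $I\subseteq\mathbb{R}$ be an open interval such that $\mathbf{E}(e^{\theta X})<\infty$ and $\mathbf{E}(X^2|\Phi(X)|e^{\theta X})<\infty$ for all $\theta\in I$. Then the function $\varrho\mapsto\mathbf{E}^{\theta(\varrho)}\Phi(X)$ is strictly convex throughout its interval of definition $J$ if and only if $\mathbb{S}$ contains at least three points and $\Phi$ is strictly convex at some point of $\mathbb{S}$. In the complementary case the function $\varrho\mapsto\mathbf{E}^{\theta(\varrho)}\Phi(X)$ is linear (i.e. affine) on $J$.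
   Context: Non-degenerate means that the distribution of $X$ is not concentrated on a single point. For $\theta\in I$ the exponentially weighted expectation is $\mathbf{E}^\theta(Y):=\mathbf{E}(Y e^{\theta X})/\mathbf{E}(e^{\theta X})$. Put $\varrho(\theta):=\mathbf{E}^\theta X$ for $\theta\in I$; this function is strictly increasing and continuous on $I$, $J:=\varrho(I)$ is a nontrivial open interval, and $\theta(\varrho)$, $\varrho\in J$, denotes the inverse function. The function $\Phi$ is said to be strictly convex at a point $z\in\mathbb{S}$ if the slope of the extended $\Phi$ jumps at $z$, i.e. $z$ is neither the maximum nor the minimum of $\mathbb{S}$ and the left and right derivatives of the extended $\Phi$ at $z$ are different. *)

(* Defs.v *)
From HB Require Import structures.
From mathcomp Require Import all_boot all_order all_algebra.
From mathcomp Require Import all_classical all_reals all_analysis.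

Set Implicit Arguments.
Unset Strict Implicit.
Unset Printing Implicit Defensive.

Import Order.TTheory GRing.Theory Num.Theory.
Import numFieldNormedType.Exports.

Local Open Scope classical_set_scope.
Local Open Scope ring_scope.
Local Open Scope convex_scope.

(* Local finiteness is taken in the whole line: bounded intervals meet S in
   finitely many points, so S has no accumulation point in R. *)
Definition discrete_set (R : realType) (S : set R) : Prop :=
  finite_set S \/
  (S #= [set: nat])%card /\ forall a b : R, finite_set (S `&` `[a, b]).

Definition closed_interval_hull (R : realType) (S : set R) : set R :=
  smallest (fun A : set R => closed A /\ is_interval A) S.

Definition left_neighbor (R : realType) (S : set R) (x : R) : R :=
  sup (S `&` [set s | s <= x]).

Definition right_neighbor (R : realType) (S : set R) (x : R) : R :=
  inf (S `&` [set s | x <= s]).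

(* For x in S both neighbours are x itself, and the value is Phi x since the
   quotient is 0 / 0 = 0. Only meaningful on closed_interval_hull S, where
   it depends only on the values of Phi on S. *)
Definition linear_extension (R : realType) (S : set R) (Phi : R -> R)
    (x : R) : R :=
  let a := left_neighbor S x in
  let b := right_neighbor S x in
  Phi a + (x - a) / (b - a) * (Phi b - Phi a).

Definition strictly_convex_at (R : realType) (S : set R) (Phi : R -> R)
    (z : R) : Prop :=
  let f := linear_extension S Phi in
  [/\ S z, ~ ubound S z, ~ lbound S z &
    exists l r : R,
      [/\ h^-1 * (f (z + h) - f z) @[h --> 0^'-] --> l,
          h^-1 * (f (z + h) - f z) @[h --> 0^'+] --> r & l <> r]].

(* Strict analogue of the library's convex_function. *)
Definition strictly_convex_function (R : realType) (D : set (convex_lmodType R^o))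
    (f : convex_lmodType R^o -> R^o) : Prop :=
  forall t : {i01 R}, 0 < t%:num < 1 ->
    {in D &, forall x y, x != y -> f (x <| t |> y) < (f x <| t |> f y : R)}.

Definition affine_on (R : realType) (D : set R) (f : R -> R) : Prop :=
  exists a b : R, forall x, D x -> f x = a * x + b.

Section tilting.
Context d (T : measurableType d) (R : realType) (P : probability T R).

(* E^theta(Y), meaningful when both expectations are finite. *)
Definition tilted_expectation (X : T -> R) (theta : R) (Y : T -> R) : R :=
  fine 'E_P[fun w => Y w * expR (theta * X w)] /
  fine 'E_P[fun w => expR (theta * X w)].

Definition tilted_mean (X : T -> R) (theta : R) : R :=
  tilted_expectation X theta X.

Definition tilted_mean_range (X : T -> R) (I : set R) : set R :=
  tilted_mean X @` I.

Definition tilt_of_mean (X : T -> R) (I : set R) : R -> R :=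
  pinv I (tilted_mean X).

End tilting.

(* Main.v *)
(* Fix tilts t1 < t2 < t3 in I and let l be the affine function that agrees
   with the function rho |-> E^theta(rho) Phi(X) at the outer means
   rho(t1), rho(t3). Then h = Phi - l is convex on S and has vanishing expectation
   under the tilts t1 and t3, so if Phi is not affine on S it changes sign, being
   negative exactly between two points u < v of S in the main case. A combination
   a e^(t1 x) + b e^(t3 x) - e^(t2 x) that vanishes at u and v has the sign of h,
   whence E(h(X) e^(t2 X)) < 0, which is strict convexity at rho(t2). No
   derivative in theta is needed. On the other side, Phi has a slope jump at a
   point of S if and only if it is not affine on S. *)

Require Import Defs.
From HB Require Import structures.
From mathcomp Require Import all_boot all_order all_algebra.
From mathcomp Require Import all_classical all_reals all_analysis.
From mathcomp Require Import measurable_realfun ring lra.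

Set Implicit Arguments.
Unset Strict Implicit.
Unset Printing Implicit Defensive.

Import Order.TTheory GRing.Theory Num.Theory.
Import numFieldNormedType.Exports.

Local Open Scope classical_set_scope.
Local Open Scope ring_scope.

(** * Inequalities for combinations of exponentials *)

Section exponentials.
Context {R : realType}.
Implicit Types u v x y z c : R.

(** The strict tangent bounds at [y], evaluated at [x] and [z] and weighted by [z - y] and [y - x],
    add up to the claim because their linear terms cancel. *)
Lemma expR_three_point_lt c x y z : c != 0 -> x < y < z ->
  (z - x) * expR (c * y) < (z - y) * expR (c * x) + (y - x) * expR (c * z).
Proof.
move=> c0 /andP[xy yz].
have tangent t : t != y -> expR (c * y) * (1 + c * (t - y)) < expR (c * t).
  move=> ty; rewrite -[X in _ < expR X](_ : c * y + c * (t - y) = _); last by ring.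
  by rewrite expRD ltr_pM2l ?expR_gt0// expR_gt1Dx// mulf_neq0// subr_eq0.
have : (z - y) * (expR (c * y) * (1 + c * (x - y))) < (z - y) * expR (c * x).
  by rewrite ltr_pM2l ?subr_gt0// tangent// lt_eqF.
have : (y - x) * (expR (c * y) * (1 + c * (z - y))) < (y - x) * expR (c * z).
  by rewrite ltr_pM2l ?subr_gt0// tangent// gt_eqF.
move: (expR (c * y)) (expR _) (expR _) => e0 e1 e2; lra.
Qed.

(** Dividing [psi] by the positive factor [expR (t2 * x)] leaves [phi], a positive combination of a
    decreasing and an increasing exponential minus 1. It is strictly convex, so its two zeros
    determine its sign everywhere. *)
Lemma two_crossing_exponential (t1 t2 t3 u v : R) : t1 < t2 < t3 -> u < v ->
  exists a b : R, let psi x := a * expR (t1 * x) + b * expR (t3 * x) - expR (t2 * x) in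
  [/\ psi u = 0, psi v = 0, (forall x, u < x < v -> psi x < 0) &
      forall x, x < u \/ v < x -> 0 < psi x].
Proof.
move=> /andP[t12 t23] uv.
pose p x := expR ((t1 - t2) * x); pose q x := expR ((t3 - t2) * x).
have pvu : p v < p u by rewrite ltr_expR; nra.
have quv : q u < q v by rewrite ltr_expR; nra.
have pv0 : 0 < p v by exact: expR_gt0.
have qu0 : 0 < q u by exact: expR_gt0.
(* Cramer's rule for the system [phi u = 0], [phi v = 0]: [D] is its determinant, [a] and [b] its
   solution. Monotonicity of [p] and [q] makes all three positive. *)
pose D := p u * q v - p v * q u.
have D0 : 0 < D by rewrite /D; nra.
pose a := (q v - q u) / D; pose b := (p u - p v) / D.
have a0 : 0 < a by rewrite divr_gt0// subr_gt0.
have b0 : 0 < b by rewrite divr_gt0// subr_gt0.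
pose phi x := a * p x + b * q x - 1.
have phiu : phi u = 0 by rewrite /phi /a /b /D; field; rewrite gt_eqF.
have phiv : phi v = 0 by rewrite /phi /a /b /D; field; rewrite gt_eqF.
have convex x y z : x < y < z ->
    (z - x) * phi y < (z - y) * phi x + (y - x) * phi z.
  move=> xyz.
  have := @expR_three_point_lt (t1 - t2) x y z; rewrite -!/(p _).
  rewrite subr_eq0 lt_eqF// => /(_ isT xyz); rewrite -(ltr_pM2l a0) => Hp.
  have := @expR_three_point_lt (t3 - t2) x y z; rewrite -!/(q _).
  rewrite subr_eq0 gt_eqF// => /(_ isT xyz); rewrite -(ltr_pM2l b0) => Hq.
  by rewrite /phi; lra.
have psiE x : a * expR (t1 * x) + b * expR (t3 * x) - expR (t2 * x) =
    expR (t2 * x) * phi x.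
  rewrite /phi /p /q; have -> : t1 * x = t2 * x + (t1 - t2) * x by ring.
  have -> : t3 * x = t2 * x + (t3 - t2) * x by ring.
  by rewrite !expRD; ring.
exists a, b; split=> [||x xuv|x xuv]; rewrite psiE ?phiu ?phiv ?mulr0//.
  rewrite pmulr_rlt0 ?expR_gt0//; have := convex _ _ _ xuv.
  by rewrite phiu phiv !mulr0 addr0 pmulr_rlt0// subr_gt0.
rewrite pmulr_rgt0 ?expR_gt0//; case: xuv => [xu|vx].
  have /convex : x < u < v by rewrite xu.
  by rewrite phiu phiv !mulr0 addr0 pmulr_rgt0// subr_gt0.
have /convex : u < v < x by rewrite uv.
by rewrite phiu phiv !mulr0 add0r pmulr_rgt0// subr_gt0.
Qed.

Lemma le_norm_expRD (x : R) : `|x| <= expR x + expR (- x).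
Proof.
have := expR_ge1Dx x; have := expR_ge1Dx (- x).
have := expR_gt0 x; have := expR_gt0 (- x); rewrite ler_norml.
move: (expR x) (expR (- x)) => a b; lra.
Qed.

(** Depending on the sign of [x], one of the two end exponents dominates. The bound is uniform in
    [c], as dominated convergence requires. *)
Lemma expR_le_sum_itv u v c x : u <= c <= v ->
  expR (c * x) <= expR (u * x) + expR (v * x).
Proof.
move=> /andP[uc cv]; have [x0|/ltW x0] := leP 0 x.
  by rewrite ler_wpDl ?expR_ge0// ler_expR ler_wpM2r.
by rewrite ler_wpDr ?expR_ge0// ler_expR ler_wnM2r.
Qed.

End exponentials.

(** * Extrema and neighbours in locally finite sets *)

Section discrete_sets.
Context {R : realType}.
Implicit Types S A : set R.

Lemma finite_set_argmin A (f : R -> R) : finite_set A -> A !=set0 ->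
  exists2 m, A m & forall y, A y -> f m <= f y.
Proof.
move=> /finite_seqP[[|x s] ->] [y0 //= _] {y0}.
elim: s x => [|y s ih] x.
  by exists x; rewrite ?mem_seq1// => y; rewrite mem_seq1 => /eqP ->.
have [m ms mle] := ih y; have [xm|mx] := leP (f x) (f m).
  exists x; first exact: mem_head.
  by move=> z; rewrite in_cons => /predU1P[->//|/mle]; exact: le_trans.
exists m; first by rewrite in_cons ms orbT.
by move=> z; rewrite in_cons => /predU1P[->|/mle//]; exact: ltW.
Qed.

Lemma discrete_set_locally_finite S a b :
  discrete_set S -> finite_set (S `&` `[a, b]).
Proof. by move=> [|[_]//]; apply: sub_finite_set => x []. Qed.

Lemma discrete_set_countable S : discrete_set S -> countable S.
Proof.
by move=> [/finite_set_countable//|[+ _]]; rewrite card_eq_le => /andP[].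
Qed.

(** Only the part of [A] between one of its members and the bound [M] matters, and local finiteness
    makes that part finite. *)
Lemma discrete_set_has_max S A M : discrete_set S -> A `<=` S -> A !=set0 ->
  ubound A M -> exists2 m, A m & ubound A m.
Proof.
move=> dS AS [a Aa] AM.
have fA : finite_set (A `&` `[a, M]).
  by apply: sub_finite_set (discrete_set_locally_finite a M dS); exact: setSI.
have [|m [Am]] := finite_set_argmin -%R fA.
  by exists a; split => //=; rewrite in_itv/= lexx AM.
rewrite /= in_itv/= => /andP[am mM] mle; exists m => // y Ay.
have [ay|/ltW ya] := leP a y; last exact: le_trans am.
by rewrite -lerN2; apply: mle; split => //=; rewrite in_itv/= ay AM.
Qed.

Lemma discrete_set_has_min S A M : discrete_set S -> A `<=` S -> A !=set0 ->
  lbound A M -> exists2 m, A m & lbound A m.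
Proof.
move=> dS AS [a Aa] AM.
have fA : finite_set (A `&` `[M, a]).
  by apply: sub_finite_set (discrete_set_locally_finite M a dS); exact: setSI.
have [|m [Am]] := finite_set_argmin id fA.
  by exists a; split => //=; rewrite in_itv/= lexx AM.
rewrite /= in_itv/= => /andP[am mM] mle; exists m => // y Ay.
have [ya|/ltW ay] := leP y a; last exact: le_trans ay.
by apply: mle; split => //=; rewrite in_itv/= ya AM.
Qed.

Lemma discrete_set_pred S z : discrete_set S -> ~ lbound S z ->
  exists p, [/\ S p, p < z & forall x, S x -> x < z -> x <= p].
Proof.
move=> dS /existsNP[x /not_implyP[Sx /negP]]; rewrite -ltNge => xz.
have [|||p [Sp pz] pmax] := @discrete_set_has_max S (S `&` [set x | x < z]) z dS.
- by move=> ? [].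
- by exists x.
- by move=> y [_ /ltW].
by exists p; split => // y Sy yz; apply: pmax.
Qed.

Lemma discrete_set_succ S z : discrete_set S -> ~ ubound S z ->
  exists n, [/\ S n, z < n & forall x, S x -> z < x -> n <= x].
Proof.
move=> dS /existsNP[x /not_implyP[Sx /negP]]; rewrite -ltNge => zx.
have [|||n [Sn zn] nmin] := @discrete_set_has_min S (S `&` [set x | z < x]) z dS.
- by move=> ? [].
- by exists x.
- by move=> y [_ /ltW].
by exists n; split => // y Sy zy; apply: nmin.
Qed.

End discrete_sets.

(** * The piecewise linear extension: one-sided slopes and convexity on [S] *)

Lemma sup_max (R : realType) (A : set R) (m : R) : A m -> ubound A m -> sup A = m.
Proof.
move=> Am ubm; apply/eqP; rewrite eq_le ge_sup//=; last by exists m.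
by rewrite ub_le_sup//; exists m.
Qed.

Lemma inf_min (R : realType) (A : set R) (m : R) : A m -> lbound A m -> inf A = m.
Proof.
move=> Am lbm; apply/eqP; rewrite eq_le lb_le_inf ?andbT//=; last by exists m.
by rewrite ge_inf//; exists m.
Qed.

Lemma conv_regularE (R : realType) (t : {i01 R}) (a b : convex_lmodType R^o) :
  conv t a b = t%:num * (a : R) + (1 - t%:num) * (b : R) :> R.
Proof. by []. Qed.

Section linear_extension.
Context {R : realType} (S : set R) (Phi : R -> R).

Lemma linear_extensionE x : S x -> linear_extension S Phi x = Phi x.
Proof.
move=> Sx; rewrite /linear_extension /left_neighbor /right_neighbor.
rewrite (@sup_max _ _ x); [|by split => /=|by move=> ? []].
rewrite (@inf_min _ _ x); [|by split => /=|by move=> ? []].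
by rewrite subrr mul0r mul0r addr0.
Qed.

Lemma linear_extension_between p n x : S p -> S n -> p < x < n ->
  (forall y, S y -> p < y -> n <= y) ->
  linear_extension S Phi x = Phi p + (x - p) / (n - p) * (Phi n - Phi p).
Proof.
move=> Sp Sn /andP[px xn] adj.
rewrite /linear_extension /left_neighbor /right_neighbor.
rewrite (@sup_max _ _ p); first rewrite (@inf_min _ _ n)//.
- by split => //=; exact: ltW.
- by move=> y [Sy /= xy]; apply: adj => //; exact: lt_le_trans xy.
- by split => //=; exact: ltW.
- move=> y [Sy /= yx]; rewrite leNgt; apply/negP => /(adj _ Sy).
  by rewrite leNgt (le_lt_trans yx).
Qed.

(** Between adjacent points of [S] the extension is a line segment, so close to [z] the difference
    quotients on each side are constant and equal to the chord slope. The one-sided derivatives are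
    therefore these two slopes. *)
Lemma strictly_convex_at_adjacent p z n : S p -> S z -> S n -> p < z < n ->
  (forall x, S x -> x < z -> x <= p) -> (forall x, S x -> z < x -> n <= x) ->
  strictly_convex_at S Phi z <->
  (Phi z - Phi p) / (z - p) <> (Phi n - Phi z) / (n - z).
Proof.
move=> Sp Sz Sn /andP[pz zn] adjp adjn.
have adjp' y : S y -> p < y -> z <= y.
  by move=> Sy py; rewrite leNgt; apply/negP => /(adjp _ Sy); rewrite leNgt py.
set l := (_ / (z - p)); set r := (_ / (n - z)).
set f := linear_extension S Phi.
have cl : h^-1 * (f (z + h) - f z) @[h --> 0^'-] --> l.
  apply: cvg_near_cst; near=> h.
  have h0 : h < 0 by near: h; exact: nbhs_left_lt.
  have ph : p - z < h by near: h; apply: nbhs_left_gt; rewrite subr_lt0.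
  rewrite /f (linear_extensionE Sz) (@linear_extension_between p z)//; last first.
    by apply/andP; split; lra.
  by rewrite /l; field; rewrite subr_eq0 gt_eqF// lt_eqF.
have cr : h^-1 * (f (z + h) - f z) @[h --> 0^'+] --> r.
  apply: cvg_near_cst; near=> h.
  have h0 : 0 < h by near: h; exact: nbhs_right_gt.
  have hn : h < n - z by near: h; apply: nbhs_right_lt; rewrite subr_gt0.
  rewrite /f (linear_extensionE Sz) (@linear_extension_between z n)//; last first.
    by apply/andP; split; lra.
  by rewrite /r; field; rewrite subr_eq0 !gt_eqF.
split => [[_ _ _ [l' [r' [cl' cr' lr']]]]|lr].
  rewrite (cvg_unique _ cl cl')//; rewrite (cvg_unique _ cr cr')//.
split => //; last by exists l, r.
- by move=> /(_ _ Sn); rewrite leNgt zn.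
- by move=> /(_ _ Sp); rewrite leNgt pz.
Unshelve. all: by end_near. Qed.

(** Convexity cleared of denominators and tested on [S] alone; in this form it visibly survives
    subtracting an affine function. *)
Definition three_point_convex (h : R -> R) := forall x y z, S x -> S y -> S z ->
  x < y < z -> (z - x) * h y <= (z - y) * h x + (y - x) * h z.

Lemma three_point_convex_linear_extension :
  convex_function (closed_interval_hull S : set R^o) (linear_extension S Phi) ->
  three_point_convex Phi.
Proof.
move=> cf x y z Sx Sy Sz /andP[xy yz].
have xz : x < z by exact: lt_trans yz.
have zx0 : 0 < z - x by rewrite subr_gt0.
(* [(z - y) / (z - x)] is the weight on [x] for which the convex combination of [x] and [z] is
   [y]. *)
have t0 : 0 <= (z - y) / (z - x) by rewrite divr_ge0 ?subr_ge0 ?ltW.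
have t1 : (z - y) / (z - x) <= 1.
  by rewrite ler_pdivrMr// mul1r lerB// ltW.
have hull w : S w -> w \in (closed_interval_hull S : set R^o).
  by move=> Sw; rewrite inE; exact: sub_smallest Sw.
have := cf (Itv01 t0 t1) x z (hull _ Sx) (hull _ Sz).
have -> : conv (Itv01 t0 t1) (x : convex_lmodType R^o) (z : convex_lmodType R^o) = y.
  by rewrite [LHS]conv_regularE /=; field; rewrite gt_eqF.
rewrite [X in _ <= X]conv_regularE /= !linear_extensionE// => Hc.
apply: le_trans (ler_wpM2l (ltW zx0) Hc) _.
by rewrite le_eqVlt; apply/orP; left; apply/eqP; field; rewrite gt_eqF.
Qed.

Lemma card_I3_le x y z : S x -> S y -> S z -> x < y < z -> (`I_3 #<= S)%card.
Proof.
move=> Sx Sy Sz /andP[xy yz]; have xz := lt_trans xy yz.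
pose f := nth 0 [:: x; y; z].
have finj : {in `I_3 &, injective f}.
  by move=> [|[|[|i]]] [|[|[|j]]]; rewrite !inE//= /f/= => _ _ E //; exfalso; lra.
move: (inj_card_eq finj); rewrite card_eq_le => /andP[_ /card_le_trans]; apply.
by apply: subset_card_le => _ [[|[|[|i]]]//= _ <-].
Qed.

End linear_extension.

(** * Slope jumps of [Phi] versus affinity on [S] *)

Section affine.
Context {R : realType} (S : set R) (Phi : R -> R).
Hypothesis S_discrete : discrete_set S.

Lemma strictly_convex_at_not_affine z :
  strictly_convex_at S Phi z -> ~ affine_on S Phi.
Proof.
move=> scz; have [Sz /(discrete_set_succ S_discrete)[n [Sn zn nS]]
  /(discrete_set_pred S_discrete)[p [Sp pz pS]] _] := scz.
have pzn : p < z < n by rewrite pz.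
move/(strictly_convex_at_adjacent Phi Sp Sz Sn pzn pS nS) : scz => slopes [a [b ab]].
apply: slopes; rewrite !ab//; transitivity a; first by field; rewrite subr_eq0 gt_eqF.
by field; rewrite subr_eq0 gt_eqF.
Qed.

(* The leftmost minimiser [m] over [S `&` `[x, w]] of [Phi] minus its chord has
   a strictly larger value at its predecessor and no smaller one at its
   successor, so the slope jumps at [m]. *)
Lemma below_chord_strictly_convex_at x y w : S x -> S y -> S w -> x < y < w ->
  (w - x) * Phi y < (w - y) * Phi x + (y - x) * Phi w ->
  exists m, strictly_convex_at S Phi m.
Proof.
move=> Sx Sy Sw /andP[xy yw] below.
(* [h] is [Phi] minus its chord over [[x, w]], multiplied by [w - x] to avoid division. *)
pose h v := (w - x) * Phi v - (w - v) * Phi x - (v - x) * Phi w.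
have hx : h x = 0 by rewrite /h; ring.
have hw : h w = 0 by rewrite /h; ring.
have hy : h y < 0 by rewrite /h; lra.
pose F := S `&` `[x, w].
have fF : finite_set F by exact: discrete_set_locally_finite.
have Fy : F y by split => //=; rewrite in_itv/= !ltW.
have [|m0 Fm0 m0min] := finite_set_argmin h fF; first by exists y.
(* The points of [F] with [h v <= h m0] are its minimisers; minimising the identity over them
   selects the leftmost. *)
have [||m [Fm hm] mleft] := @finite_set_argmin _ (F `&` [set v | h v <= h m0]) id.
- by apply: sub_finite_set fF; exact: subIsetl.
- by exists m0; split => /=.
have hm0 : h m < 0 by rewrite (le_lt_trans hm)// (le_lt_trans _ hy)// m0min.
case: Fm; rewrite /= in_itv/= => Sm /andP[]; rewrite le_eqVlt => /predU1P[xm|xm].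
  by move: hm0; rewrite -xm hx ltxx.
rewrite le_eqVlt => /predU1P[mw|mw]; first by move: hm0; rewrite mw hw ltxx.
have [|p [Sp pm pS]] := @discrete_set_pred _ S m S_discrete.
  by move/(_ _ Sx); rewrite leNgt xm.
have [|n [Sn mn nS]] := @discrete_set_succ _ S m S_discrete.
  by move/(_ _ Sw); rewrite leNgt mw.
have xp : x <= p by exact: pS.
have nw : n <= w by exact: nS.
have Fp : F p by split => //=; rewrite in_itv/= xp ltW// (lt_trans pm).
have Fn : F n by split => //=; rewrite in_itv/= nw ltW// (lt_trans xm).
have hmp : h m < h p.
  rewrite ltNge; apply/negP => hpm; have : m <= p.
    by apply: mleft; split => //=; exact: le_trans hm.
  by rewrite leNgt pm.
have hmn : h m <= h n by rewrite (le_trans hm)// m0min.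
exists m; apply/(strictly_convex_at_adjacent Phi Sp Sm Sn _ pS nS); first by rewrite pm.
set l := (_ / (m - p)); set r := (_ / (n - m)) => lr.
have Pp : Phi m - Phi p = (m - p) * l by rewrite /l; field; rewrite subr_eq0 gt_eqF.
have Pn : Phi n - Phi m = (n - m) * l by rewrite lr /r; field; rewrite subr_eq0 gt_eqF.
(* If both slopes equal [l], then [h] changes at the same rate [k] on either side of [m]. The strict
   drop from [p] to [m] forces [k < 0], while [h m <= h n] forces [0 <= k]. *)
pose k := (w - x) * l + Phi x - Phi w.
have hp : h m - h p = (m - p) * k.
  rewrite (_ : _ - _ = (w - x) * (Phi m - Phi p) + (m - p) * (Phi x - Phi w)).
    by rewrite Pp /k; ring.
  by rewrite /h; ring.
have hn : h n - h m = (n - m) * k.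
  rewrite (_ : _ - _ = (w - x) * (Phi n - Phi m) + (n - m) * (Phi x - Phi w)).
    by rewrite Pn /k; ring.
  by rewrite /h; ring.
have : k < 0 by rewrite -(@pmulr_rlt0 _ (m - p)) ?subr_gt0// -hp subr_lt0.
by apply/negP; rewrite -leNgt -(@pmulr_rge0 _ (n - m)) ?subr_gt0// -hn subr_ge0.
Qed.

(** Without affinity some three points of the graph are not collinear, and convexity places the
    middle one strictly below the chord. These points also witness the cardinality bound. *)
Lemma not_affine_jump s t : S s -> S t -> s < t ->
  three_point_convex S Phi -> ~ affine_on S Phi ->
  (`I_3 #<= S)%card /\ exists z, strictly_convex_at S Phi z.
Proof.
move=> Ss St st cvx naff.
suff [x [y [w [Sx Sy Sw xyw]]]] : exists x y w, [/\ S x, S y, S w, x < y < w &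
    (w - x) * Phi y != (w - y) * Phi x + (y - x) * Phi w].
  rewrite neq_lt (ltNge (_ + _)) cvx//= orbF => below; split; first exact: card_I3_le xyw.
  exact: below_chord_strictly_convex_at below.
apply: contrapT => /forallNP collinear; apply: naff.
have {}collinear x y w : S x -> S y -> S w -> x < y < w ->
    (w - x) * Phi y = (w - y) * Phi x + (y - x) * Phi w.
  move=> Sx Sy Sw xyw; apply/eqP; apply: contrapT => /negP ne.
  by apply: (collinear x); exists y, w.
have ts0 : t - s != 0 by rewrite subr_eq0 gt_eqF.
(* The line through the graph points over [s] and [t]; collinearity puts every other point on it, in
   each of the possible orders. *)
exists ((Phi t - Phi s) / (t - s)), ((t * Phi s - s * Phi t) / (t - s)) => u Su.
apply: (mulfI ts0).
transitivity ((Phi t - Phi s) * u + (t * Phi s - s * Phi t)); last by field.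
have [us|su|->] := ltgtP u s; last by ring.
  have /(collinear _ _ _ Su Ss St) : u < s < t by rewrite us.
  by move=> E; lra.
have [ut|tu|->] := ltgtP u t; last by ring.
  have /(collinear _ _ _ Ss Su St) : s < u < t by rewrite su.
  by move=> E; lra.
have /(collinear _ _ _ Ss St Su) : s < t < u by rewrite st.
by move=> E; lra.
Qed.

End affine.

(** * Expectations of functions of [X] and their signs *)

Section expectation_of_function.
Context {R : realType} {d : measure_display} {T : measurableType d}.
Context (P : probability T R) (X : {RV P >-> R}).
Implicit Types (k : R -> R) (S : set R).

Definition integrable_of k := P.-integrable setT (EFin \o (k \o X)).

Definition mean_of k := \int[P]_w (k \o X) w.

Lemma integrable_ofD k1 k2 : integrable_of k1 -> integrable_of k2 ->
  integrable_of (fun x => k1 x + k2 x).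
Proof. by move=> i1 i2; exact: (integrableD measurableT i1 i2). Qed.

Lemma integrable_ofZ a k : integrable_of k -> integrable_of (fun x => a * k x).
Proof. by move=> ik; exact: (integrableZl measurableT a ik). Qed.

Lemma mean_ofD k1 k2 : integrable_of k1 -> integrable_of k2 ->
  mean_of (fun x => k1 x + k2 x) = mean_of k1 + mean_of k2.
Proof. by move=> i1 i2; exact: (RintegralD measurableT i1 i2). Qed.

Lemma mean_ofZ a k : integrable_of k ->
  mean_of (fun x => a * k x) = a * mean_of k.
Proof. by move=> ik; exact: (RintegralZl a measurableT ik). Qed.

Lemma le_integrable_of k g : measurable_fun setT k ->
  (forall x, `|k x| <= g x) -> integrable_of g -> integrable_of k.
Proof.
move=> mk kg; apply: le_integrable => //.
  by apply/measurable_EFinP; exact: measurableT_comp.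
by move=> w _ /=; rewrite lee_fin (le_trans (kg _))// ler_norm.
Qed.

Lemma ge0_integrable_of k : measurable_fun setT k -> (forall x, 0 <= k x) ->
  ('E_P[k \o X] < +oo)%E -> integrable_of k.
Proof.
move=> mk k0; rewrite unlock => koo; apply/integrableP; split.
  by apply/measurable_EFinP; exact: measurableT_comp.
by under eq_integral do rewrite /= ger0_norm//.
Qed.

Lemma tilted_expectationE k t :
  tilted_expectation P X t (fun w => k (X w)) =
  mean_of (fun x => k x * expR (t * x)) / mean_of (fun x => expR (t * x)).
Proof. by rewrite /tilted_expectation unlock. Qed.

Section atoms.
Context S.
Hypothesis S_countable : countable S.
Hypothesis X_supported : distribution P X S = 1%E.
Hypothesis S_atoms : forall z, S z -> (0 < distribution P X [set z])%E.

Lemma ae_supported : {ae P, forall w, S (X w)}.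
Proof.
have mS : measurable S by exact: countable_measurable.
have mXS : measurable (X @^-1` S) by exact: measurable_funPTI.
exists (~` (X @^-1` S)); split => //; first exact: measurableC.
rewrite probability_setC//; move: X_supported; rewrite /distribution /pushforward => ->.
by rewrite subee.
Qed.

Lemma eq_mean_of k1 k2 : integrable_of k1 -> measurable_fun setT k2 ->
  (forall x, S x -> k1 x = k2 x) -> mean_of k1 = mean_of k2.
Proof.
move=> /integrableP[m1 _] m2 k12; congr fine; apply: ae_eq_integral => //.
  by apply/measurable_EFinP; exact: measurableT_comp.
by apply: filterS ae_supported => w Sw _ /=; rewrite k12.
Qed.

(** A zero expectation would make [k] vanish almost surely along [X], but the atom at [z] has
    positive probability. *)
Lemma mean_of_gt0 k z : integrable_of k -> (forall x, S x -> 0 <= k x) ->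
  S z -> 0 < k z -> 0 < mean_of k.
Proof.
move=> ik k0 Sz kz.
have [mk _] := integrableP _ _ _ ik.
(* The sign of [k] is known on [S] only; passing to the absolute value gives an integrand
   nonnegative everywhere with the same mean. *)
have -> : mean_of k = mean_of (fun x => `|k x|).
  congr fine; apply: ae_eq_integral => //.
    apply/measurable_EFinP; apply: (measurableT_comp (@normr_measurable R setT)).
    exact/measurable_EFinP.
  by apply: filterS ae_supported => w Sw _ /=; rewrite ger0_norm ?k0.
rewrite lt_neqAle; apply/andP; split; last first.
  by rewrite /mean_of Rintegral_ge0// => w _; exact: normr_ge0.
apply/eqP => /esym mean0.
have /(ae_eq_integral_abs P measurableT mk) : (\int[P]_w `|(EFin \o (k \o X)) w| = 0)%E.
  have ikabs := integrable_abse ik.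
  by apply/eqP; rewrite -fine_eq0; [apply/eqP; exact: mean0|exact: integrable_fin_num].
move=> [N [mN N0 kN]].
have : (P [set w | X w = z] <= P N)%E.
  apply: le_measure; rewrite ?inE//.
    exact: (measurable_funPTI X (measurable_set1 z)).
  move=> w /= Xwz; apply: kN => /= /(_ I) [] /eqP.
  by rewrite Xwz gt_eqF.
by rewrite N0 leNgt (S_atoms Sz).
Qed.
(** Subtracting [c] times the vanishing mean, with [c] the value of [expR ((t2 - t1) * x)] at [v],
    turns the integrand into [expR (t1 * x) * (k x * (expR ((t2 - t1) * x) - c))]. Both inner
    factors change sign at [v] in the same direction, so the product is nonnegative on [S]. *)
Lemma single_crossing_mean_gt0 k t1 t2 v n : t1 < t2 ->
  (forall x, S x -> 0 <= (x - v) * k x) -> S n -> 0 < (n - v) * k n ->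
  integrable_of (fun x => k x * expR (t1 * x)) ->
  integrable_of (fun x => k x * expR (t2 * x)) ->
  mean_of (fun x => k x * expR (t1 * x)) = 0 ->
  0 < mean_of (fun x => k x * expR (t2 * x)).
Proof.
move=> t12 k_sign Sn kn i1 i2 mean0.
pose c := expR ((t2 - t1) * v).
have -> : mean_of (fun x => k x * expR (t2 * x)) =
    mean_of (fun x => k x * expR (t2 * x) + (- c) * (k x * expR (t1 * x))).
  rewrite mean_ofD//; last exact: integrable_ofZ.
  by rewrite mean_ofZ// mean0 mulr0 addr0.
have E x : k x * expR (t2 * x) + (- c) * (k x * expR (t1 * x)) =
    expR (t1 * x) * (k x * (expR ((t2 - t1) * x) - c)).
  have -> : t2 * x = t1 * x + (t2 - t1) * x by ring.
  by rewrite expRD; ring.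
have t0 : 0 < t2 - t1 by rewrite subr_gt0.
apply: (@mean_of_gt0 _ n) => //.
- by apply: integrable_ofD => //; exact: integrable_ofZ.
- move=> x /k_sign; rewrite E (pmulr_rge0 _ (expR_gt0 (t1 * x))).
  have [xv|vx|->] := ltgtP x v; last by rewrite /c !subrr mulr0.
    rewrite nmulr_rge0 ?subr_lt0// => kx; apply: mulr_le0 => //.
    by rewrite subr_le0 ler_expR ler_pM2l// ltW.
  rewrite pmulr_rge0 ?subr_gt0// => kx; apply: mulr_ge0 => //.
  by rewrite subr_ge0 ler_expR ler_pM2l// ltW.
- move: kn; rewrite E (pmulr_rgt0 _ (expR_gt0 (t1 * n))).
  have [xv|vx|->] := ltgtP n v; last by rewrite subrr mul0r ltxx.
    rewrite nmulr_rgt0 ?subr_lt0// => kx; rewrite nmulr_rgt0//.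
    by rewrite subr_lt0 ltr_expR ltr_pM2l.
  rewrite pmulr_rgt0 ?subr_gt0// => kx; rewrite pmulr_rgt0//.
  by rewrite subr_gt0 ltr_expR ltr_pM2l.
Qed.

Hypothesis S_discrete : discrete_set S.

(* With [h < 0] strictly between [u] and [v] and [h >= 0] outside, the product
   of [h] with the combination of exponentials vanishing at [u] and [v] is
   nonnegative. When [h] changes sign only once, a single crossing already
   contradicts the vanishing of both means. *)
Lemma convex_mean_lt0 h t1 t2 t3 y : t1 < t2 < t3 ->
  three_point_convex S h -> S y -> h y != 0 ->
  integrable_of (fun x => h x * expR (t1 * x)) ->
  integrable_of (fun x => h x * expR (t2 * x)) ->
  integrable_of (fun x => h x * expR (t3 * x)) ->
  mean_of (fun x => h x * expR (t1 * x)) = 0 ->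
  mean_of (fun x => h x * expR (t3 * x)) = 0 ->
  mean_of (fun x => h x * expR (t2 * x)) < 0.
Proof.
move=> t123 hcvx Sy hy i1 i2 i3 mean1 mean3.
have /andP[t12 t23] := t123; have t13 := lt_trans t12 t23.
(* If [h] were nonnegative on [S], its value at [y] would make the mean under [t1] positive. *)
have [n [Sn hn]] : exists n, S n /\ h n < 0.
  apply: contrapT => /forallNP h_ge0.
  have {}h_ge0 x : S x -> 0 <= h x.
    by move=> Sx; rewrite leNgt; apply/negP => hx; exact: (h_ge0 x).
  suff : 0 < mean_of (fun x => h x * expR (t1 * x)) by rewrite mean1 ltxx.
  apply: (@mean_of_gt0 _ y) => //.
    by move=> x Sx; rewrite mulr_ge0 ?expR_ge0 ?h_ge0.
  by rewrite mulr_gt0 ?expR_gt0// lt_def hy h_ge0.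
(* The nonnegative points of [h] to the left and to the right of [n]. The greatest element of [A]
   and the least of [B], when they exist, delimit the stretch where [h] is negative. *)
pose A := [set x | [/\ S x, x < n & 0 <= h x]].
pose B := [set x | [/\ S x, n < x & 0 <= h x]].
have AS : A `<=` S by move=> x [].
have BS : B `<=` S by move=> x [].
have An : ubound A n by move=> x [_ /ltW].
have Bn : lbound B n by move=> x [_ /ltW].
(* Negative values at both [x] and [n] would, by convexity, make [h u] negative. *)
have left_ge0 u x : A u -> S x -> x < u -> 0 <= h x.
  move=> [Su un hu] Sx xu.
  have := hcvx x u n Sx Su Sn; rewrite xu un => /(_ isT) cvx.
  by rewrite leNgt; apply/negP => hx; move: cvx; rewrite leNgt => /negP; apply; nra.
have right_ge0 v x : B v -> S x -> v < x -> 0 <= h x.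
  move=> [Sv nv hv] Sx vx.
  have := hcvx n v x Sn Sv Sx; rewrite vx nv => /(_ isT) cvx.
  by rewrite leNgt; apply/negP => hx; move: cvx; rewrite leNgt => /negP; apply; nra.
have [/(discrete_set_has_max S_discrete AS)/(_ An)[u Au umax]|A0] := pselect (A !=set0);
have [/(discrete_set_has_min S_discrete BS)/(_ Bn)[v Bv vmin]|B0] := pselect (B !=set0).
- have [Su un hu] := Au; have [Sv nv hv] := Bv.
  have uv := lt_trans un nv.
  have [a [b /= [psiu psiv psi_lt0 psi_gt0]]] := two_crossing_exponential t123 uv.
  pose psi x := a * expR (t1 * x) + b * expR (t3 * x) - expR (t2 * x).
  rewrite -!/(psi _) in psiu psiv.
  rewrite -oppr_gt0.
  have -> : - mean_of (fun x => h x * expR (t2 * x)) =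
      mean_of (fun x => a * (h x * expR (t1 * x)) +
        (b * (h x * expR (t3 * x)) + (-1) * (h x * expR (t2 * x)))).
    rewrite !mean_ofD ?mean_ofZ ?mean1 ?mean3 ?mulr0 ?add0r ?mulN1r//;
      do ?[exact: integrable_ofZ|apply: integrable_ofD].
  have E x : a * (h x * expR (t1 * x)) +
      (b * (h x * expR (t3 * x)) + (-1) * (h x * expR (t2 * x))) = h x * psi x.
    by rewrite /psi; ring.
  apply: (@mean_of_gt0 _ n) => //.
  + by do ?[exact: integrable_ofZ|apply: integrable_ofD].
  + move=> x Sx; rewrite E.
    have [xu|ux|->] := ltgtP x u; last by rewrite psiu mulr0.
      by rewrite mulr_ge0 ?(left_ge0 u)// ltW// psi_gt0//; left.
    have [vx|xv|<-] := ltgtP v x; last by rewrite psiv mulr0.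
      by rewrite mulr_ge0 ?(right_ge0 v)// ltW// psi_gt0//; right.
    apply: mulr_le0; last by rewrite ltW// psi_lt0// ux.
    rewrite leNgt; apply/negP => hx; have [xn|nx|xn] := ltgtP x n.
    * have : x <= u by apply: umax; split => //; exact: ltW.
      by rewrite leNgt ux.
    * have : v <= x by apply: vmin; split => //; exact: ltW.
      by rewrite leNgt xv.
    * by move: hx; rewrite xn ltNge ltW.
  + by rewrite E nmulr_rgt0// psi_lt0// un.
(* With [B] empty, [- h] crosses zero once, upwards, at [u]; its mean cannot vanish under both [t1]
   and [t3]. *)
- have [Su un hu] := Au.
  have N t : (fun x => - h x * expR (t * x)) = (fun x => (-1) * (h x * expR (t * x))).
    by apply/funext => x; rewrite mulN1r mulNr.
  suff : 0 < mean_of (fun x => - h x * expR (t3 * x)).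
    by rewrite N mean_ofZ// mean3 mulr0 ltxx.
  apply: (@single_crossing_mean_gt0 _ t1 t3 u n) => //; rewrite ?N;
    try exact: integrable_ofZ; last by rewrite mean_ofZ// mean1 mulr0.
    move=> x Sx; have [xu|ux|->] := ltgtP x u; last by rewrite subrr mul0r.
      by rewrite nmulr_rge0 ?subr_lt0// oppr_le0 (left_ge0 u).
    rewrite pmulr_rge0 ?subr_gt0// oppr_ge0 leNgt; apply/negP => hx.
    have [xn|nx|xn] := ltgtP x n.
    + have : x <= u by apply: umax; split => //; exact: ltW.
      by rewrite leNgt ux.
    + by apply: B0; exists x; split => //; exact: ltW.
    + by move: hx; rewrite xn ltNge ltW.
  by rewrite mulr_gt0 ?subr_gt0 ?oppr_gt0.
(* With [A] empty, [h] itself crosses zero once, upwards, at [v], with the same contradiction. *)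
- have [Sv nv hv] := Bv.
  suff : 0 < mean_of (fun x => h x * expR (t3 * x)) by rewrite mean3 ltxx.
  apply: (@single_crossing_mean_gt0 h t1 t3 v n) => //; last first.
    by rewrite nmulr_rgt0 ?subr_lt0.
  move=> x Sx; have [vx|xv|<-] := ltgtP v x; last by rewrite subrr mul0r.
    by rewrite pmulr_rge0 ?subr_gt0// (right_ge0 v).
  rewrite nmulr_rge0 ?subr_lt0// leNgt; apply/negP => hx.
  have [xn|nx|xn] := ltgtP x n.
  + by apply: A0; exists x; split => //; exact: ltW.
  + have : v <= x by apply: vmin; split => //; exact: ltW.
    by rewrite leNgt xv.
  + by move: hx; rewrite xn ltNge ltW.
(* With both sets empty, [h] is negative on all of [S], which contradicts the zero mean under
   [t1]. *)
- suff : 0 < mean_of (fun x => (-1) * (h x * expR (t1 * x))).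
    by rewrite mean_ofZ// mean1 mulr0 ltxx.
  apply: (@mean_of_gt0 _ n) => //; first exact: integrable_ofZ.
    move=> x Sx; rewrite mulN1r oppr_ge0 pmulr_lle0 ?expR_gt0//.
    rewrite leNgt; apply/negP => hx; have [xn|nx|xn] := ltgtP x n.
    + by apply: A0; exists x; split => //; exact: ltW.
    + by apply: B0; exists x; split => //; exact: ltW.
    + by move: hx; rewrite xn ltNge ltW.
  by rewrite mulN1r oppr_gt0 pmulr_llt0 ?expR_gt0.
Qed.

End atoms.

End expectation_of_function.

(** * Measurability and continuity of tilted integrals *)

Section tilting.
Context {R : realType} {d : measure_display} {T : measurableType d}.
Context (P : probability T R) (X : {RV P >-> R}).

Lemma measurable_expR_scale (t : R) : measurable_fun setT (fun x : R => expR (t * x)).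
Proof. by apply: measurableT_comp => //; exact: measurable_funM. Qed.

Lemma measurable_tilt (k : R -> R) t : measurable_fun setT k ->
  measurable_fun setT (fun x => k x * expR (t * x)).
Proof. by move=> mk; apply: measurable_funM => //; exact: measurable_expR_scale. Qed.

(** Every subset of a countable set of reals is measurable, so arbitrary values on [S] are
    harmless. *)
Lemma measurable_restrict_countable (S : set R) (Phi : R -> R) :
  countable S -> measurable_fun setT (Phi \_ S).
Proof.
move=> cS; apply/measurable_restrict => //.
  exact: countable_measurable.
move=> _ B _; apply: countable_measurable => //.
by apply: sub_countable cS; apply: subset_card_le => x [[]].
Qed.

Lemma integrable_sum_tilts (k : R -> R) u v :
  integrable_of X (fun x => k x * expR (u * x)) ->
  integrable_of X (fun x => k x * expR (v * x)) ->
  integrable_of X (fun x => `|k x * expR (u * x)| + `|k x * expR (v * x)|).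
Proof.
by move=> iu iv; apply: integrable_ofD;
  [exact: (integrable_abse iu)|exact: (integrable_abse iv)].
Qed.

Lemma tilt_le_sum_itv (k : R -> R) u v t x : u <= t <= v ->
  `|k x * expR (t * x)| <= `|k x * expR (u * x)| + `|k x * expR (v * x)|.
Proof.
move=> utv; rewrite !normrM -mulrDr !(ger0_norm (expR_ge0 _)) ler_wpM2l//.
exact: expR_le_sum_itv.
Qed.

(** Dominated convergence: the tilts at the end parameters [u] and [v] together dominate every tilt
    between them. *)
Lemma continuous_mean_tilt (k : R -> R) u v : measurable_fun setT k ->
  integrable_of X (fun x => k x * expR (u * x)) ->
  integrable_of X (fun x => k x * expR (v * x)) ->
  {in `]u, v[%classic, continuous (fun t : R => mean_of X (fun x => k x * expR (t * x)))}.
Proof.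
move=> mk iu iv.
have itv t : `]u, v[%classic t -> u <= t <= v.
  by rewrite /= in_itv/= => /andP[/ltW -> /ltW ->].
pose g (w : T) := `|k (X w) * expR (u * X w)| + `|k (X w) * expR (v * X w)|.
apply: (@continuity_under_integral _ _ _ P
  (fun t w => k (X w) * expR (t * X w)) setT measurableT u v _ _ g).
- move=> t /itv utv; apply: (@le_integrable_of _ _ _ P X (fun x => k x * expR (t * x))
    _ _ _ (integrable_sum_tilts iu iv)).
    exact: measurable_tilt.
  by move=> x; exact: tilt_le_sum_itv.
- apply: aeW => w _ t _.
  apply: (@cvgM _ _ _ _ (fun=> k (X w)) (fun s => expR (s * X w))).
    exact: cvg_cst.
  apply: (@continuous_comp _ _ _ (fun s : R => s * X w) expR).
    exact: mulrr_continuous.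
  exact: continuous_expR.
- exact: integrable_sum_tilts.
- by move=> t /itv utv; apply: aeW => w _; exact: tilt_le_sum_itv.
Qed.

(** * The tilted mean, its inverse, and the tilted expectation of [Phi] *)

Section tilted_mean.
Context (S : set R) (Phi : R -> R) (I : set R).
Hypothesis X_nondegenerate : ~ exists c : R, distribution P X [set c] = 1%E.
Hypothesis S_discrete : discrete_set S.
Hypothesis X_supported : distribution P X S = 1%E.
Hypothesis S_atoms : forall z : R, S z -> (0 < distribution P X [set z])%E.
Hypothesis Phi_convex : three_point_convex S Phi.
Hypothesis I_open : open I.
Hypothesis I_interval : is_interval I.
Hypothesis exp_finite : forall theta : R, I theta ->
  ('E_P[fun w => expR (theta * X w)] < +oo)%E.
Hypothesis Phi_finite : forall theta : R, I theta ->
  ('E_P[fun w => (X w ^+ 2 * `|(Phi \_ S) (X w)| * expR (theta * X w))%R] < +oo)%E.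

Let S_countable : countable S.
Proof. exact: discrete_set_countable. Qed.

Lemma two_atoms : exists s t, [/\ S s, S t & s < t].
Proof.
have [s Ss] : S !=set0.
  apply/set0P/negP => /eqP S0; move: X_supported; rewrite S0 measure0.
  by move=> /eqP; rewrite eq_sym onee_eq0.
have [t [St ts]] : exists t, S t /\ t != s.
  apply: contrapT => /forallNP only_s; apply: X_nondegenerate; exists s.
  rewrite -X_supported; congr distribution; apply/seteqP; split => [_ ->//|x Sx] /=.
  by apply: contrapT => /eqP xs; exact: (only_s x).
by move: ts; rewrite neq_lt => /orP[ts|st]; [exists t, s|exists s, t].
Qed.

Lemma open_around t : I t -> exists2 e, 0 < e & I (t - e) /\ I (t + e).
Proof.
move=> It; have /nbhs_ballP[e /= e0 eI] : nbhs t I by exact: open_nbhs_nbhs.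
exists (e / 2); first by rewrite divr_gt0.
have e2 : `|e / 2| < e by rewrite ger0_norm ?divr_ge0 ?ltW//; lra.
split; apply: eI; rewrite /ball/=.
  by rewrite opprB addrC subrK.
by rewrite opprD addrA subrr add0r normrN.
Qed.

Lemma integrable_exp t : I t -> integrable_of X (fun x => expR (t * x)).
Proof.
move=> It; apply: ge0_integrable_of; first exact: measurable_expR_scale.
  by move=> x; exact: expR_ge0.
exact: exp_finite.
Qed.

(** Since [e * x] is bounded in absolute value by [expR (e * x) + expR (- (e * x))], the exponential
    moments at [t - e] and [t + e], available by openness of [I], control the first moment at
    [t]. *)
Lemma integrable_id_exp t : I t -> integrable_of X (fun x => x * expR (t * x)).
Proof.
move=> It; have [e e0 [Ite Ite']] := open_around It.
apply: (@le_integrable_of _ _ _ P X _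
  (fun x => e^-1 * (expR ((t + e) * x) + expR ((t - e) * x)))).
- exact: measurable_tilt.
- move=> x; rewrite normrM (ger0_norm (expR_ge0 _)) mulrC.
  rewrite mulrDl mulrBl !expRD -mulrDr mulrCA ler_pM2l ?expR_gt0//.
  rewrite ler_pdivlMl// -[X in X * _](gtr0_norm e0) -normrM.
  exact: le_norm_expRD.
- by apply: integrable_ofZ; apply: integrable_ofD; exact: integrable_exp.
Qed.

(** Where [1 < |x|] the factor [x ^+ 2] exceeds 1, so the second-moment hypothesis dominates; where
    [|x| <= 1] there are finitely many points of [S], so [F] is bounded. *)
Lemma integrable_Phi_exp t : I t ->
  integrable_of X (fun x => (Phi \_ S) x * expR (t * x)).
Proof.
move=> It; set F := Phi \_ S.
have mF : measurable_fun setT F by exact: measurable_restrict_countable.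
have [M Mge] : exists M, forall x, `|x| <= 1 -> `|F x| <= M.
  have fin := discrete_set_locally_finite (-1) 1 S_discrete.
  have [|S1] := pselect (S `&` `[-1, 1] !=set0).
    move=> /(finite_set_argmin (fun x => - `|F x|) fin)[m _ mmax].
    exists `|F m| => x; rewrite ler_norml => x1.
    have [Sx|nSx] := pselect (S x); last by rewrite {1}/F patchE memNset// normr0.
    by rewrite -lerN2; apply: mmax; split => //=; rewrite in_itv.
  exists 0 => x; rewrite ler_norml => x1; rewrite /F patchE.
  case: ifPn => [|_]; last by rewrite normr0.
  by rewrite inE => Sx; exfalso; apply: S1; exists x; split => //=; rewrite in_itv.
apply: (@le_integrable_of _ _ _ P X _
  (fun x => x ^+ 2 * `|F x| * expR (t * x) + `|M| * expR (t * x))).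
- exact: measurable_tilt.
- move=> x; rewrite normrM (ger0_norm (expR_ge0 _)) -mulrDl ler_wpM2r ?expR_ge0//.
  have F0 := normr_ge0 (F x); have [x1|x1] := leP `|x| 1.
    have := Mge _ x1; have := ler_norm M.
    have : 0 <= x ^+ 2 * `|F x| by rewrite mulr_ge0 ?sqr_ge0.
    by move: (x ^+ 2 * _) => y; lra.
  rewrite ler_wpDr// ler_peMl// -real_normK ?num_real// expr_ge1// ltW//.
- apply: integrable_ofD; last exact/integrable_ofZ/integrable_exp.
  apply: ge0_integrable_of; last exact: Phi_finite.
    apply: measurable_tilt; apply: measurable_funM => //.
    exact: measurableT_comp.
  by move=> x; rewrite mulr_ge0 ?expR_ge0// mulr_ge0 ?sqr_ge0.
Qed.

Local Notation partition t := (mean_of X (fun x => expR (t * x))).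
Local Notation rho t := (tilted_mean P X t).
Local Notation G t := (tilted_expectation P X t (fun w => (Phi \_ S) (X w))).

Lemma partition_gt0 t : I t -> 0 < partition t.
Proof.
move=> It; have [s [_ [Ss _ _]]] := two_atoms.
apply: (mean_of_gt0 S_countable X_supported S_atoms (integrable_exp It) _ Ss).
  by move=> x _; exact: expR_ge0.
exact: expR_gt0.
Qed.

Lemma tilted_meanE t : rho t = mean_of X (fun x => x * expR (t * x)) / partition t.
Proof. exact: (tilted_expectationE X id t). Qed.

(** Passes between unnormalised integrals, to which the sign arguments apply, and tilted
    expectations: an affine function of [X] has as tilted expectation its value at the tilted
    mean. *)
Lemma mean_tilt_sub_affine (F : R -> R) a b t : I t ->
  integrable_of X (fun x => F x * expR (t * x)) ->
  integrable_of X (fun x => (F x - (a * x + b)) * expR (t * x)) /\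
  mean_of X (fun x => (F x - (a * x + b)) * expR (t * x)) =
  partition t * (tilted_expectation P X t (fun w => F (X w)) - (a * rho t + b)).
Proof.
move=> It iF.
have -> : (fun x => (F x - (a * x + b)) * expR (t * x)) =
    (fun x => F x * expR (t * x) +
       ((- a) * (x * expR (t * x)) + (- b) * expR (t * x))).
  by apply/funext => x; ring.
have iid := integrable_id_exp It; have ie := integrable_exp It.
split.
  by do ?[exact: integrable_ofZ|apply: integrable_ofD].
rewrite !mean_ofD ?mean_ofZ//; do ?[exact: integrable_ofZ|apply: integrable_ofD].
rewrite tilted_meanE tilted_expectationE.
by field; rewrite gt_eqF// partition_gt0.
Qed.

Lemma tilted_mean_lt t1 t2 : I t1 -> I t2 -> t1 < t2 -> rho t1 < rho t2.
Proof.
move=> I1 I2 t12; have [s [t [Ss St st]]] := two_atoms.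
have [n [Sn nc]] : exists n, S n /\ n != rho t1.
  have [sc|sc] := eqVneq s (rho t1); last by exists s.
  by exists t; split => //; rewrite -sc gt_eqF.
have [i1 m1] := mean_tilt_sub_affine 0 (rho t1) I1 (integrable_id_exp I1).
have [i2 m2] := mean_tilt_sub_affine 0 (rho t1) I2 (integrable_id_exp I2).
have := single_crossing_mean_gt0 S_countable X_supported S_atoms t12 _ Sn _ i1 i2.
have rhoE u : tilted_expectation P X u (fun w => X w) = rho u by [].
rewrite m1 m2 !mul0r !add0r !rhoE => /(_ (rho t1)).
rewrite (subrr (rho t1)) mulr0 pmulr_rgt0 ?partition_gt0// subr_gt0; apply => //.
- by move=> x _; rewrite mul0r add0r -expr2 sqr_ge0.
- by rewrite -expr2 lt_def sqr_ge0 sqrf_eq0 subr_eq0 nc.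
Qed.

Lemma tilted_mean_inj : {in I &, injective (tilted_mean P X)}.
Proof.
move=> t1 t2; rewrite !inE => I1 I2 E.
have [lt|lt|//] := ltgtP t1 t2.
  by have := tilted_mean_lt I1 I2 lt; rewrite E ltxx.
by have := tilted_mean_lt I2 I1 lt; rewrite E ltxx.
Qed.

Lemma tilt_of_meanK t : I t -> tilt_of_mean P X I (rho t) = t.
Proof. by move=> It; rewrite /tilt_of_mean pinvKV ?inE//; exact: tilted_mean_inj. Qed.

Lemma tilted_mean_continuous t : I t -> {for t, continuous (tilted_mean P X)}.
Proof.
move=> It; have [e e0 [Iu Iv]] := open_around It.
have tuv : t \in `](t - e), (t + e)[%classic.
  by rewrite inE/= in_itv/= ltrBlDr ltrDl e0.
have exp1 s : (fun x : R => expR (s * x)) = (fun x => cst 1 x * expR (s * x)).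
  by apply/funext => x; rewrite mul1r.
rewrite (_ : tilted_mean P X = fun t => mean_of X (fun x => x * expR (t * x)) /
    mean_of X (fun x => cst 1 x * expR (t * x))); last first.
  by apply/funext => s; rewrite tilted_meanE exp1.
apply: cvgM.
  by apply: (continuous_mean_tilt _ (integrable_id_exp Iu) (integrable_id_exp Iv)).
apply: cvgV; first by rewrite -exp1 gt_eqF// partition_gt0.
by apply: (@continuous_mean_tilt (cst 1) _ _ _ _ _ t tuv) => //;
  rewrite -exp1; exact: integrable_exp.
Qed.

Lemma tilted_mean_range_interval : is_interval (tilted_mean_range P X I).
Proof.
move=> _ _ [t1 I1 <-] [t2 I2 <-] r /andP[r1 r2].
wlog t12 : t1 t2 I1 I2 r1 r2 / t1 <= t2 => [hw|].
  have [|/tilted_mean_lt - /(_ I2 I1) lt] := leP t1 t2; first exact: hw.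
  by move: (le_trans r1 r2); rewrite leNgt lt.
have I12 t : t \in `[t1, t2] -> I t.
  by rewrite in_itv/=; exact: I_interval.
have [||t tin <-] := @IVT _ (tilted_mean P X) t1 t2 r t12.
- apply: continuous_in_subspaceT => t; rewrite inE => /I12.
  exact: tilted_mean_continuous.
- by rewrite (min_idPl (le_trans r1 r2)) (max_idPr (le_trans r1 r2)) r1.
by exists t => //; exact: I12.
Qed.

Lemma three_point_tilt_lt t1 t2 t3 : I t1 -> I t2 -> I t3 -> t1 < t2 < t3 ->
  ~ affine_on S Phi ->
  (rho t3 - rho t1) * G t2 < (rho t3 - rho t2) * G t1 + (rho t2 - rho t1) * G t3.
Proof.
move=> I1 I2 I3 t123 naff; have /andP[t12 t23] := t123.
have r13 := tilted_mean_lt I1 I3 (lt_trans t12 t23).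
have r0 : rho t3 - rho t1 != 0 by rewrite subr_eq0 gt_eqF.
pose a := (G t3 - G t1) / (rho t3 - rho t1).
pose b := G t1 - a * rho t1.
pose h x := (Phi \_ S) x - (a * x + b).
have PhiE x : S x -> (Phi \_ S) x = Phi x by move=> Sx; rewrite patchE mem_set.
have hcvx : three_point_convex S h.
  move=> x y z Sx Sy Sz xyz; have := Phi_convex Sx Sy Sz xyz.
  rewrite /h !PhiE//; move: (Phi x) (Phi y) (Phi z) => px py pz; lra.
have [y [Sy hy]] : exists y, S y /\ h y != 0.
  apply: contrapT => /forallNP h0; apply: naff; exists a, b => x Sx.
  apply/eqP; rewrite -subr_eq0 -(PhiE _ Sx); apply: contrapT => /negP hx.
  exact: (h0 x).
have [i1 m1] := mean_tilt_sub_affine a b I1 (integrable_Phi_exp I1).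
have [i2 m2] := mean_tilt_sub_affine a b I2 (integrable_Phi_exp I2).
have [i3 m3] := mean_tilt_sub_affine a b I3 (integrable_Phi_exp I3).
have := convex_mean_lt0 S_countable X_supported S_atoms S_discrete t123 hcvx Sy hy i1 i2 i3.
have E1 : G t1 - (a * rho t1 + b) = 0 by rewrite /b; ring.
have E3 : G t3 - (a * rho t3 + b) = 0 by rewrite /b /a; field.
rewrite m1 m2 m3 E1 E3 !mulr0 => /(_ erefl erefl).
rewrite pmulr_rlt0 ?partition_gt0// subr_lt0 -(ltr_pM2l (x := rho t3 - rho t1)) ?subr_gt0//.
move=> /lt_le_trans; apply; rewrite le_eqVlt; apply/orP; left; apply/eqP.
by rewrite /b /a; field.
Qed.

Lemma affine_tilt a b t : I t -> (forall x, S x -> Phi x = a * x + b) ->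
  G t = a * rho t + b.
Proof.
move=> It Phi_ab.
have [i m] := mean_tilt_sub_affine a b It (integrable_Phi_exp It).
have : mean_of X (fun x => ((Phi \_ S) x - (a * x + b)) * expR (t * x)) = mean_of X (cst 0).
  apply: (eq_mean_of S_countable X_supported i) => // x Sx.
  by rewrite patchE mem_set// Phi_ab// subrr mul0r.
rewrite m {2}/mean_of Rintegral_cst//= mul0r => /eqP.
by rewrite mulf_eq0 gt_eqF ?partition_gt0//= subr_eq0 => /eqP.
Qed.

End tilted_mean.
End tilting.
Section strict_convexity.
Context {R : realType} (D : set R) (f : R -> R).

Lemma three_point_strictly_convex_function :
  (forall x y z, D x -> D z -> x < y < z ->
     (z - x) * f y < (z - y) * f x + (y - x) * f z) ->
  strictly_convex_function D f.
Proof.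
move=> H t /andP[t0 t1] x y; rewrite !inE => Dx Dy.
rewrite [X in f X < _]conv_regularE [X in _ < X]conv_regularE.
move: (t%:num) t0 t1 => {}t t0 t1.
set m := t * x + (1 - t) * y; rewrite neq_lt => /orP[xy|yx].
- have xmy : x < m < y by rewrite /m; apply/andP; split; nra.
  rewrite -(@ltr_pM2l _ (y - x)) ?subr_gt0//.
  apply: lt_le_trans (H _ _ _ Dx Dy xmy) _.
  by rewrite le_eqVlt /m; apply/orP; left; apply/eqP; ring.
- have ymx : y < m < x by rewrite /m; apply/andP; split; nra.
  rewrite -(@ltr_pM2l _ (x - y)) ?subr_gt0//.
  apply: lt_le_trans (H _ _ _ Dy Dx ymx) _.
  by rewrite le_eqVlt /m; apply/orP; left; apply/eqP; ring.
Qed.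

Lemma affine_not_strictly_convex_function x y : is_interval D -> D x -> D y ->
  x < y -> affine_on D f -> ~ strictly_convex_function D f.
Proof.
move=> itvD Dx Dy xy [a [b fab]].
have h0 : 0 <= 2^-1 :> R by rewrite invr_ge0.
have h1 : 2^-1 <= 1 :> R by rewrite invf_le1// ler1n.
move=> /(_ (Itv01 h0 h1)); rewrite /= invr_gt0 ltr0n invf_lt1// ltr1n.
move=> /(_ isT x y); rewrite !inE lt_eqF// => /(_ Dx Dy isT).
rewrite [X in f X < _]conv_regularE [X in _ < X]conv_regularE /=.
rewrite !fab//; first lra.
by apply: (itvD _ _ Dx Dy); apply/andP; split; lra.
Qed.

End strict_convexity.

(* Phi \_ S is constant off S: the values of Phi outside S, which X takes with
   probability 0, play no role. *)
Theorem theorem2p2 (R : realType) (d : measure_display) (T : measurableType d)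
    (P : probability T R) (X : {RV P >-> R}) (S : set R) (Phi : R -> R)
    (I : set R)
    (X_nondegenerate : ~ exists c : R, distribution P X [set c] = 1%E)
    (S_discrete : discrete_set S)
    (X_supported : distribution P X S = 1%E)
    (S_atoms : forall z : R, S z -> (0 < distribution P X [set z])%E)
    (Phi_convex : convex_function (closed_interval_hull S : set R^o)
                    (linear_extension S Phi))
    (I_open : open I) (I_interval : is_interval I) (I_neq0 : I !=set0)
    (exp_finite : forall theta : R, I theta ->
      ('E_P[fun w => expR (theta * X w)] < +oo)%E)
    (Phi_finite : forall theta : R, I theta ->
      ('E_P[fun w => (X w ^+ 2 * `|(Phi \_ S) (X w)| * expR (theta * X w))%R]
         < +oo)%E) :
  let J := tilted_mean_range P X I in
  let g := fun rho : R =>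
    tilted_expectation P X (tilt_of_mean P X I rho)
      (fun w => (Phi \_ S) (X w)) in
  let jump := (`I_3 #<= S)%card /\ exists z : R, strictly_convex_at S Phi z in
  (strictly_convex_function J g <-> jump) /\ (~ jump -> affine_on J g).
Proof.
move=> J g jump.
have Phi3 := three_point_convex_linear_extension Phi_convex.
have [s [t [Ss St st]]] := two_atoms X_nondegenerate X_supported.
have rho_lt := tilted_mean_lt X_nondegenerate S_discrete X_supported S_atoms
  I_open exp_finite.
have gE theta : I theta -> g (tilted_mean P X theta) =
    tilted_expectation P X theta (fun w => (Phi \_ S) (X w)).
  move=> Itheta; rewrite /g (@tilt_of_meanK _ _ _ P X S)//.
have itvJ : is_interval J by exact: (@tilted_mean_range_interval _ _ _ P X S).
have jump_affine : jump <-> ~ affine_on S Phi.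
  split=> [[_ [z]]|]; first exact: strictly_convex_at_not_affine.
  exact: (not_affine_jump S_discrete Ss St).
have affine_g : ~ jump -> affine_on J g.
  move=> /(contra_not jump_affine.2)/contrapT[a [b Phi_ab]].
  exists a, b => _ [theta Itheta <-]; rewrite gE//.
  exact: (@affine_tilt _ _ _ P X S Phi I).
split=> //; split=> [scvx|/jump_affine naff].
  apply: contrapT => /affine_g affg.
  have [theta Itheta] := I_neq0.
  have [e e0 [_ Ie]] := open_around I_open Itheta.
  have lt : theta < theta + e by rewrite ltrDl.
  apply: (affine_not_strictly_convex_function (x := tilted_mean P X theta)
    (y := tilted_mean P X (theta + e)) itvJ _ _ _ affg scvx).
  - by exists theta.
  - by exists (theta + e).
  - exact: rho_lt.
apply: three_point_strictly_convex_function => x y z Jx Jz xyz.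
have Jy : J y.
  by have /andP[/ltW xy /ltW yz] := xyz; apply: (itvJ _ _ Jx Jz); rewrite xy.
case: Jx Jy Jz xyz => [t1 I1 <-] [t2 I2 <-] [t3 I3 <-] /andP[r12 r23].
have mono u v : I u -> I v -> tilted_mean P X u < tilted_mean P X v -> u < v.
  move=> Iu Iv uv; rewrite ltNge le_eqVlt; apply/negP => /predU1P[vu|vu].
    by move: uv; rewrite vu ltxx.
  by have := rho_lt _ _ Iv Iu vu; rewrite ltNge ltW.
rewrite !gE//; apply: (@three_point_tilt_lt _ _ _ P X S Phi I) => //.
by apply/andP; split; exact: mono.
Qed.
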